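(* Let $G$ be a tree and let $T'$ be any EPT of $G$ produced by the balanced cut algorithm. Then $\mathrm{EPTsum}(G,T')\le \frac{3}{2}\,\mathrm{EPTsum}(G)$.
   Context: An edge partition tree (EPT) of a tree $G$ is a rooted full binary tree defined inductively: if $G$ has a single vertex, its EPT is a single node (a leaf identified with that vertex); otherwise the root corresponds to an edge $e\in E(G)$ and its two children are roots of EPTs of the two components of $G\setminus e$. Leaves are identified with vertices of $G$ and internal nodes with edges of $G$. The depth of a node is its distance from the root. $\mathrm{EPTsum}(G,T)$ is the sum over all vertices of $G$ of the depth of the corresponding leaf in $T$, and $\mathrm{EPTsum}(G)$ is the minimum of $\mathrm{EPTsum}(G,T)$ over all EPTs $T$ of $G$. An edge $e$ of a tree $H$ is balanced if it minimizes, over all edges of $H$, the number of vertices of the largest component of $H\setminus e$. The balanced cut algorithm builds an EPT of $G$ by choosing a balanced edge $e$ of $G$ as the root and recursively building EPTs of the components of $G\setminus e$ in the same way, making their roots the children of $e$ (ties among balanced edges broken arbitrarily). *)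

(* Defs.v *)
From mathcomp Require Import all_boot all_order all_algebra.
From mathcomp Require Import boolp.

Set Implicit Arguments.
Unset Strict Implicit.
Unset Printing Implicit Defensive.

(* A finite graph whose vertices are drawn from V; an edge is the set of its
   two endpoints. Vertex sets are subsets of V so that a graph and all the
   components obtained from it by cutting edges share one ambient type. *)
Record graph (V : finType) := Graph { vset : {set V}; eset : {set {set V}} }.

Section Graphs.
Variable V : finType.
Implicit Types (G : graph V) (A : {set V}) (e f : {set V}).

Definition simple_graph G : Prop :=
  {in eset G, forall f, #|f| = 2 /\ f \subset vset G}.

Definition adj G : rel V := fun x y => [set x; y] \in eset G.

Definition connected G : Prop :=
  vset G != set0 /\ {in vset G &, forall x y, connect (adj G) x y}.

Definition acyclic G : Prop :=
  forall c : seq V, 2 < size c -> ~ ucycle (adj G) c.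

Definition is_tree G : Prop :=
  [/\ simple_graph G, connected G & acyclic G].

Definition del_edge G e : graph V := Graph (vset G) (eset G :\ e).

Definition induced G A : graph V := Graph A [set f in eset G | f \subset A].

(* The vertex sets of the connected components; the component itself is the
   subgraph [induced G A] for A in [components G]. *)
Definition components G : {set {set V}} :=
  [set [set y in vset G | connect (adj G) x y] | x in vset G].

Definition largest_comp G : nat := \max_(A in components G) #|A|.

Definition balanced G e : Prop :=
  e \in eset G /\
  {in eset G, forall f,
    largest_comp (del_edge G e) <= largest_comp (del_edge G f)}.

End Graphs.

(* Binary trees whose leaves carry vertices and whose internal nodes carry
   edges. *)
Inductive ptree (V : finType) :=
  | Leaf of V
  | Node of {set V} & ptree V & ptree V.

Section EPT.
Variable V : finType.
Implicit Types (G : graph V) (T : ptree V).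

Inductive is_ept : graph V -> ptree V -> Prop :=
  | EptLeaf G v : vset G = [set v] -> is_ept G (Leaf v)
  | EptNode G e A B T1 T2 :
      e \in eset G ->
      A != B -> components (del_edge G e) = [set A; B] ->
      is_ept (induced (del_edge G e) A) T1 ->
      is_ept (induced (del_edge G e) B) T2 ->
      is_ept G (Node e T1 T2).

(* The possible outputs of the balanced cut algorithm, over all ways of
   breaking ties. *)
Inductive balanced_cut : graph V -> ptree V -> Prop :=
  | BalLeaf G v : vset G = [set v] -> balanced_cut G (Leaf v)
  | BalNode G e A B T1 T2 :
      balanced G e ->
      A != B -> components (del_edge G e) = [set A; B] ->
      balanced_cut (induced (del_edge G e) A) T1 ->
      balanced_cut (induced (del_edge G e) B) T2 ->
      balanced_cut G (Node e T1 T2).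

Fixpoint leaves T : seq V :=
  match T with
  | Leaf v => [:: v]
  | Node _ T1 T2 => leaves T1 ++ leaves T2
  end.

(* Distance from the root to the leaf v; only meaningful when v is a leaf of
   T, which in an EPT of G holds for exactly the vertices of G. *)
Fixpoint leaf_depth T (v : V) : nat :=
  match T with
  | Leaf _ => 0
  | Node _ T1 T2 =>
      (if v \in leaves T1 then leaf_depth T1 v else leaf_depth T2 v).+1
  end.

Definition ept_cost G T : nat := \sum_(v in vset G) leaf_depth T v.

Definition is_ept_cost G : pred nat :=
  fun n => `[< exists2 T, is_ept G T & ept_cost G T = n >].

(* EPTsum(G), the least cost of an EPT of G. The value 0 is a placeholder for
   graphs without an EPT; every tree has one. *)
Definition EPTsum G : nat :=
  match pselect (exists n, is_ept_cost G n) with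
  | left exG => ex_minn exG
  | right _ => 0
  end.

End EPT.

(* Main.v *)
(* Any partition tree T of X induces partition trees T|A and T|B on the two
   sides of an edge e = A|B of X, and cost(T) = gain + cost(T|A) + cost(T|B),
   whereas the balanced cut pays |X| for e. It would suffice that the gain is
   at least 2|X|/3 at every step of the balanced algorithm. Let e be balanced
   and |B| <= |A|. If e is not the root of T, look at the first cuts of T above
   e. Balancedness forces every branch cut off A to have at most |B| vertices;
   hence the gain is at least |A|, and at least 2|X|/3 unless the first two cuts
   lie on different sides and the first cut of one of the sides, say Z, leaves
   few vertices of Z next to e. Then the root of T|Z cuts off a piece Z' with at
   least |Z|/2 vertices, so the balanced cut of Z gains at least |Z'|, and the
   gains at X and Z together are at least 2(|X| + |Z|)/3. Induction on |X|
   concludes. *)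
Require Import Defs.
From mathcomp Require Import all_boot all_order all_algebra.
From mathcomp Require Import zify boolp.
Set Implicit Arguments.
Unset Strict Implicit.
Unset Printing Implicit Defensive.

(** * Cuts of vertex sets by an abstract family of sides *)

Section CutSystem.
Variables (V : finType) (F : {set {set V}}) (U : {set V}).
Implicit Types (X Y Z A B P Q R s t : {set V}) (c : nat).

Hypothesis sideC : forall s, s \in F -> ~: s \in F.
(** One of the four corners formed by two sides inside [U] is empty, as for the sides of two edges
    of a tree. *)
Hypothesis side_cross : forall s t, s \in F -> t \in F ->
  [|| U :&: s \subset t, [disjoint U :&: s & t], U :\: s \subset t
    | [disjoint U :\: s & t]].

Definition cut X P Q : Prop :=
  X \subset U /\
  exists2 s, s \in F & [/\ P = X :&: s, Q = X :\: s, P != set0 & Q != set0].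

Lemma cut_sym X P Q : cut X P Q -> cut X Q P.
Proof.
case=> XU [s Fs [-> -> P0 Q0]]; split=> //; exists (~: s); first exact: sideC.
by rewrite !setDE setCK -setDE; split.
Qed.

Lemma cut_card X P Q : cut X P Q -> [/\ #|X| = #|P| + #|Q|, 0 < #|P| & 0 < #|Q|].
Proof.
by case=> XU [s _ [-> -> P0 Q0]]; rewrite -(cardsID s X) !card_gt0.
Qed.

Lemma cut_subset X P Q : cut X P Q -> (P \subset X) /\ (Q \subset X).
Proof. by case=> _ [s _ [-> -> _ _]]; rewrite subsetIl subsetDl. Qed.

(** The side cutting [P] off [X] also cuts it off [A]; the side defining [A] separates the remainder
    [R = A :\: P] from [B] inside [Q]. *)
Lemma cut_nested X A B P Q : cut X A B -> cut X P Q -> P \subset A ->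
  P = A /\ Q = B \/ exists2 R, cut A P R & cut Q R B.
Proof.
move=> [XU [s Fs [eA eB A0 B0]]] [_ [t Ft [eP eQ P0 Q0]]] sPA.
have [AP|AP] := boolP (A \subset P).
  left; have ePA : P = A by apply/eqP; rewrite eqEsubset sPA.
  split=> //; have -> : B = X :\: A by rewrite eA setDIr setDv set0U.
  by rewrite -ePA eP eQ setDIr setDv set0U.
right; exists (A :\: P).
  split; first by rewrite eA (subset_trans (subsetIl _ _)).
  exists t => //; split=> //; last by rewrite setD_eq0.
    apply/setP=> z; move/subsetP/(_ z): sPA; rewrite eP eA !inE.
    by case: (z \in X); case: (z \in s); case: (z \in t) => // /(_ isT).
  by apply/setP=> z; rewrite eP eA !inE; case: (z \in X); case: (z \in t).
split; first by rewrite eQ (subset_trans (subsetDl _ _)).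
exists s => //; split=> //; last 1 first.
- by rewrite setD_eq0.
- by apply/setP=> z; rewrite eP eA eQ !inE; case: (z \in X); case: (z \in t).
apply/setP=> z; move/subsetP/(_ z): sPA; rewrite eP eB eA eQ !inE.
by case: (z \in X); case: (z \in s); case: (z \in t) => // /(_ isT).
Qed.

Lemma cut_cross X A B P Q : cut X A B -> cut X P Q ->
  [\/ P \subset A, P \subset B, Q \subset A | Q \subset B].
Proof.
move=> [XU [s Fs [-> -> _ _]]] [_ [t Ft [-> -> _ _]]].
have inU z : z \in X -> z \in U by move/subsetP: XU; apply.
case/or4P: (side_cross Ft Fs) => [/subsetP st|/pred0P st|/subsetP st|/pred0P st].
- constructor 1; apply/subsetP=> z; rewrite !inE => /andP[zX zt].
  by rewrite zX st // !inE inU.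
- constructor 2; apply/subsetP=> z; rewrite !inE => /andP[zX zt].
  by have:= st z; rewrite /= !inE inU // zt zX /= => ->.
- constructor 3; apply/subsetP=> z; rewrite !inE => /andP[zt zX].
  by rewrite zX st // !inE inU // zt.
- constructor 4; apply/subsetP=> z; rewrite !inE => /andP[zt zX].
  by have:= st z; rewrite /= !inE inU // zt zX /= => ->.
Qed.

(** Only the cost of a tree is recorded: a node over [X] adds [#|X|] because it pushes every leaf
    below it one level down. *)
Inductive cut_tree : {set V} -> nat -> Prop :=
  | CutLeaf X : #|X| = 1 -> cut_tree X 0
  | CutNode X P Q c d : cut X P Q -> cut_tree P c -> cut_tree Q d ->
      cut_tree X (#|X| + c + d).

Definition balanced_split X A B : Prop :=
  cut X A B /\
  forall P Q, cut X P Q -> maxn #|A| #|B| <= maxn #|P| #|Q|.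

Inductive balanced_tree : {set V} -> nat -> Prop :=
  | BalancedLeaf X : #|X| = 1 -> balanced_tree X 0
  | BalancedNode X A B c d : balanced_split X A B ->
      balanced_tree A c -> balanced_tree B d ->
      balanced_tree X (#|X| + c + d).

(* If the root edge of the tree differs from the edge of the cut [A | B], it
   lies inside one of the two sides; [roots_in A B] is the case where it cuts
   a piece [P] off the side [A], leaving [R] on the same side as [B]. *)
Definition roots_in A B X c : Prop :=
  exists P R Q, exists d d',
    [/\ [/\ cut X P Q, cut A P R & cut Q R B],
        cut_tree P d, cut_tree Q d' & c = #|X| + d + d'].

Lemma cut_tree_root X A B c : cut_tree X c -> cut X A B ->
  [\/ exists d d', [/\ cut_tree A d, cut_tree B d' & c = #|X| + d + d'],
      roots_in A B X c | roots_in B A X c].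
Proof.
move=> TX XAB; case: TX XAB => {X c} [X X1 /cut_card[]|X P Q c d XPQ TP TQ XAB].
  by lia.
wlog sPAB : P Q c d XPQ TP TQ / P \subset A \/ P \subset B.
  move=> wl; case: (cut_cross XAB XPQ) => sub;
    first [by apply: wl XPQ TP TQ _; auto
          |by rewrite addnAC; apply: wl (cut_sym XPQ) TQ TP _; auto].
case: sPAB => sP.
  have [[<- <-]|[R APR QRB]] := cut_nested XAB XPQ sP.
    by constructor 1; exists c, d.
  by constructor 2; exists P, R, Q, c, d.
have [[<- <-]|[R APR QRB]] := cut_nested (cut_sym XAB) XPQ sP.
  by constructor 1; exists d, c; split=> //; rewrite addnAC.
by constructor 3; exists P, R, Q, c, d.
Qed.

(* [gains A B g c]: the trees induced on the two sides [A] and [B] by a tree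
   of cost [c] together save at least [g]. *)
Definition gains A B g c : Prop :=
  exists d d', [/\ cut_tree A d, cut_tree B d' & d + d' + g <= c].

Lemma gains_sym A B g c : gains A B g c -> gains B A g c.
Proof. by case=> d [d' [TA TB le]]; exists d', d; split=> //; rewrite (addnC d'). Qed.

(** A root inside one side is paid on that side only, so the size of the other side is saved at
    once; below it only the existence of induced trees matters. *)
Lemma gains_side X A B c : cut_tree X c -> cut X A B ->
  gains A B #|A| c \/ gains A B #|B| c.
Proof.
have [n] := ubnP #|X|; elim: n => // n IHn in X A B c * => ltXn TX XAB.
have key Y Z : #|X| = #|Y| + #|Z| -> roots_in Y Z X c -> gains Y Z #|Z| c.
  move=> cX [P [R [Q [d [d' [[XPQ YPR QRZ] TP TQ ->]]]]]].
  have [eX _ _] := cut_card XPQ; have [eQ _ _] := cut_card QRZ.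
  have [eY P0 _] := cut_card YPR.
  have ltQ : #|Q| < n by lia.
  have [g [f [f' [TR TZ le]]]] : exists g, gains R Z g d'.
    by case: (IHn _ _ _ _ ltQ TQ QRZ) => h; [exists #|R| | exists #|Z|].
  by exists (#|Y| + d + f), f'; split=> //; [exact: CutNode TP TR|lia].
have [eX _ _] := cut_card XAB.
case: (cut_tree_root TX XAB) => [[d [d' [TA TB ->]]]|rA|rB].
- by left; exists d, d'; split=> //; lia.
- by right; apply: key rA.
- by left; apply: gains_sym; apply: key rB; lia.
Qed.

(** Quantifying over all of [F], not over the cuts of one set, lets the property pass to subsets of
    [A]. *)
Definition small_branches A B k : Prop :=
  forall s, s \in F -> [disjoint B & s] -> ~~ (A \subset s) -> #|A :&: s| <= k.

Lemma small_branchesW A B R k :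
  R \subset A -> small_branches A B k -> small_branches R B k.
Proof.
move=> sRA smA s Fs Bs sRs; apply: leq_trans (smA s Fs Bs _).
  by rewrite subset_leq_card // setSI.
by apply: contraNN sRs; apply: subset_trans.
Qed.

Lemma small_branches_cut X A B P Q R k : small_branches A B k ->
  cut X P Q -> cut A P R -> cut Q R B -> #|P| <= k.
Proof.
move=> smA [XU [s Fs [eP eQ _ _]]] APR QRB.
have [sPA _] := cut_subset APR; have [_ sBQ] := cut_subset QRB.
have [eA _ R0] := cut_card APR.
have disB : [disjoint B & s].
  apply/pred0P=> z /=; apply/negP=> /andP[/(subsetP sBQ)].
  by rewrite eQ inE => /andP[/negbTE->].
have sAX : A \subset X.
  case: APR => _ [t _ [eP' eR _ _]]; rewrite -(setID A t) -eP' -eR subUset.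
  rewrite eP subsetIl /=.
  have [+ _] := cut_subset QRB; rewrite eQ => /subset_trans; apply.
  exact: subsetDl.
have ePA : P = A :&: s.
  apply/eqP; rewrite eqEsubset subsetI sPA eP subsetIr /=.
  exact: setSI.
rewrite ePA; apply: smA => //.
by apply/negP=> /setIidPl; rewrite -ePA => eq; move: eA; rewrite -eq; lia.
Qed.

(* Cutting a branch of [A] that is no larger than [B] saves [#|B|] while
   shrinking [A] by at most that much. *)
Lemma gains_small_branches X A B c : cut_tree X c -> cut X A B ->
  small_branches A B #|B| -> gains A B #|A| c.
Proof.
have [n] := ubnP #|X|; elim: n => // n IHn in X A c * => ltXn TX XAB smA.
have [eX A0 B0] := cut_card XAB.
case: (cut_tree_root TX XAB) => [[d [d' [TA TB ->]]]|
  [P [R [Q [d [d' [[XPQ APR QRB] TP TQ ->]]]]]]|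
  [P [R [Q [d [d' [[XPQ BPR QRA] TP TQ ->]]]]]]].
- by exists d, d'; split=> //; lia.
- have leP := small_branches_cut smA XPQ APR QRB.
  have [eX' P0 _] := cut_card XPQ.
  have [eQ _ _] := cut_card QRB; have [eA _ _] := cut_card APR.
  have [_ sRA] := cut_subset APR.
  have ltQ : #|Q| < n by lia.
  have [f [f' [TR TB le]]] := IHn _ _ _ ltQ TQ QRB (small_branchesW sRA smA).
  by exists (#|A| + d + f), f'; split=> //; [exact: CutNode TP TR|lia].
(* A root inside [B] saves [#|A|] at once, so any induced trees below it will do. *)
- have [g [f [f' [TR TA le]]]] : exists g, gains R A g d'.
    by case: (gains_side TQ QRA) => h; [exists #|R| | exists #|A|].
  by exists f', (#|B| + d + f); split=> //; [exact: CutNode TP TR|lia].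
Qed.

(** * Consequences of balancedness and the approximation bound *)

Lemma balanced_split_sym X A B : balanced_split X A B -> balanced_split X B A.
Proof.
by case=> /cut_sym XBA min; split=> // P Q XPQ; rewrite maxnC; apply: min.
Qed.

(** If a branch of [A] had more than [#|B|] vertices, cutting it off [X] would leave two parts both
    smaller than [A], against minimality. *)
Lemma balanced_small_branches X A B :
  balanced_split X A B -> small_branches A B #|B|.
Proof.
case=> XAB min s Fs Bs sAs; have [eX A0 B0] := cut_card XAB.
have [-> //|As0] := eqVneq (A :&: s) set0; first by rewrite cards0.
have [sAX sBX] := cut_subset XAB.
have eXs : X :&: s = A :&: s.
  have eAB : X = A :|: B.
    by case: XAB => _ [t _ [-> -> _ _]]; rewrite setID.
  by rewrite eAB setIUl (disjoint_setI0 Bs) setU0.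
have lt : #|A :&: s| < #|A|.
  by apply: proper_card; rewrite properE subsetIl subsetI subxx.
have cXs : cut X (A :&: s) (X :\: s).
  case: XAB => XU _; split=> //; exists s => //; split=> //.
  rewrite -card_gt0; have := cardsID s X; rewrite eXs; lia.
have [eX' _ _] := cut_card cXs.
have := min _ _ cXs; lia.
Qed.

(** If [P] were strictly inside a balanced side, [P | Q] would be a better split. If [Q] is strictly
    inside [A], with [R] the rest of [A], the root saves [#|B|] and the small branches of [R] save
    [#|R|] more, in total [#|P|]. *)
Lemma gains_balanced Y P Q A B c d : cut Y P Q -> #|Q| <= #|P| ->
  cut_tree P c -> cut_tree Q d -> balanced_split Y A B ->
  gains A B #|P| (#|Y| + c + d).
Proof.
move=> YPQ leQP TP TQ bal; have [eY P0 Q0] := cut_card YPQ.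
wlog sub : A B bal / P \subset A \/ Q \subset A.
  move=> wl; have [YAB _] := bal; have bal' := balanced_split_sym bal.
  case: (cut_cross YAB YPQ) => sub;
    first [by apply: wl bal _; auto
          |by apply: gains_sym; apply: wl bal' _; auto].
have [YAB min] := bal; have [eY' A0 B0] := cut_card YAB.
case: sub => sub.
  have [[<- <-]|[R APR QRB]] := cut_nested YAB YPQ sub.
    by exists c, d; split=> //; lia.
  have [eA _ R0] := cut_card APR.
  by have := min _ _ YPQ; lia.
have [[<- <-]|[R AQR PRB]] := cut_nested YAB (cut_sym YPQ) sub.
  by exists d, c; split=> //; lia.
have [_ sRA] := cut_subset AQR; have [eA _ _] := cut_card AQR.
have smR := small_branchesW sRA (balanced_small_branches bal).
have [f [f' [TR TB le]]] := gains_small_branches TP PRB smR.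
have [eP _ _] := cut_card PRB.
by exists (#|A| + d + f), f'; split=> //; [exact: CutNode TQ TR|lia].
Qed.

Theorem balanced_tree_approx X c c' :
  cut_tree X c -> balanced_tree X c' -> 2 * c' <= 3 * c.
Proof.
have [n] := ubnP #|X|; elim: n => // n IHn in X c c' * => ltXn TX BX.
case: BX TX ltXn => {X c'} [//|X A B a b bal BA BB] TX ltXn.
wlog leBA : A B a b bal BA BB / #|B| <= #|A|.
  move=> wl; case: (leqP #|B| #|A|) => [|/ltnW]; first exact: wl bal BA BB.
  by rewrite addnAC; apply: wl (balanced_split_sym bal) BB BA.
have [XAB _] := bal; have [eX A0 B0] := cut_card XAB.
have direct g : gains A B g c -> 2 * #|X| <= 3 * g -> 2 * (#|X| + a + b) <= 3 * c.
  case=> d [d' [TA TB le]] leg.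
  have ltA : #|A| < n by lia.
  have ltB : #|B| < n by lia.
  have := IHn _ _ _ ltA TA BA; have := IHn _ _ _ ltB TB BB; lia.
(* A child [Z] of the root whose induced tree has root [P | Q] with the larger
   part [P] is cut once more by the balanced algorithm, which saves [#|P|]. *)
have expand Z z P Q d d' : #|Z| < n -> balanced_tree Z z -> cut Z P Q ->
    #|Q| <= #|P| -> cut_tree P d -> cut_tree Q d' ->
    2 * z + 3 * #|P| <= 5 * #|Z| + 3 * d + 3 * d'.
  move=> ltZ BZ; case: BZ ltZ => {Z z} [Z Z1 _ /cut_card[]|Z A' B' a' b' bal' BA' BB' ltZ].
    by lia.
  move=> ZPQ leQP TP TQ.
  have [f [f' [TA' TB' le]]] := gains_balanced ZPQ leQP TP TQ bal'.
  have [/cut_card[eZ _ _] _] := bal'.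
  have ltA : #|A'| < n by lia.
  have ltB : #|B'| < n by lia.
  (* The factor 5 on [#|Z|] is 2 for the balanced root plus 3 for the root of the induced tree. *)
  have := IHn _ _ _ ltA TA' BA'; have := IHn _ _ _ ltB TB' BB'; lia.
have ltA : #|A| < n by lia.
have ltB : #|B| < n by lia.
have smA := balanced_small_branches bal.
case: (cut_tree_root TX XAB) => [[d [d' [TA TB eq]]]|
  [P [R [Q [d [d' [[XPQ APR QRB] TP TQ eq]]]]]]|
  [P [R [Q [d [d' [[XPQ BPR QRA] TP TQ eq]]]]]]].
- by apply: (direct #|X|); [exists d, d'; split=> //; lia|lia].
- have leP := small_branches_cut smA XPQ APR QRB.
  have [eA P0 R0] := cut_card APR; have [eQ _ _] := cut_card QRB.
  (* When [B] has at most half the size of [A], the gain [#|A|] already reaches two thirds of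
     [#|X|]. *)
  have [leBA2|ltAB] := leqP (2 * #|B|) #|A|.
    by apply: (direct #|A|); [exact: gains_small_branches TX XAB smA|lia].
  case: (cut_tree_root TQ QRB) => [[f [f' [TR TB eq']]]|
    [P2 [R2 [Q2 [f [f' [[QPQ RPR QRB2] TP2 TQ2 eq']]]]]]|
    [P2 [R2 [Q2 [f [f' [[QPQ BPR QRB2] TP2 TQ2 eq']]]]]]].
  + apply: (direct #|X|); last by lia.
    by exists (#|A| + d + f), f'; split=> //; [exact: CutNode TP TR|lia].
  (* Two successive cuts inside [A] save [#|B|] each. *)
  + have [g [h [h' [TR2 TB le]]]] : exists g, gains R2 B g f'.
      by case: (gains_side TQ2 QRB2) => h; [exists #|R2| | exists #|B|].
    apply: (direct (2 * #|B|)); last by lia.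
    exists (#|A| + d + (#|R| + f + h)), h'; split=> //; last by lia.
    exact: CutNode APR TP (CutNode RPR TP2 TR2).
  (* The cut in [A] saves [#|B|], the following one in [B] saves [#|R|], and [gains_side] adds
     [#|R2|] or [#|R|]. If the total is too small, [leP] makes [P2], respectively [P], the larger
     part of its side, so that [expand] applies. *)
  + have [eB P20 R20] := cut_card BPR.
    case: (gains_side TQ2 QRB2) => [] [h [h' [TR2 TR le]]];
      have TA := CutNode APR TP TR; have TB := CutNode BPR TP2 TR2.
    * have [le3|lt3] := leqP (2 * #|X|) (3 * (#|B| + #|R| + #|R2|)).
        apply: direct le3.
        by exists (#|A| + d + h'), (#|B| + f + h); split=> //; lia.
      have leR2 : #|R2| <= #|P2| by lia.
      have := expand _ _ _ _ _ _ ltB BB BPR leR2 TP2 TR2.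
      have := IHn _ _ _ ltA TA BA; lia.
    * have [le3|lt3] := leqP (2 * #|X|) (3 * (#|B| + 2 * #|R|)).
        apply: direct le3.
        by exists (#|A| + d + h'), (#|B| + f + h); split=> //; lia.
      have leR : #|R| <= #|P| by lia.
      have := expand _ _ _ _ _ _ ltA BA APR leR TP TR.
      have := IHn _ _ _ ltB TB BB; lia.
- have [eB P0 R0] := cut_card BPR; have [eQ _ _] := cut_card QRA.
  (* The root saves [#|A|], at least half of [#|X|]. A further [#|A|] suffices; a further [#|R|]
     that is too small forces [#|R| <= #|P|], and then [B] is expanded. *)
  case: (gains_side TQ QRA) => [] [f [f' [TR TA le]]]; have TB := CutNode BPR TP TR.
  + have [le3|lt3] := leqP (2 * #|X|) (3 * (#|A| + #|R|)).
      by apply: direct le3; exists f', (#|B| + d + f); split=> //; lia.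
    have leR : #|R| <= #|P| by lia.
    have := expand _ _ _ _ _ _ ltB BB BPR leR TP TR.
    have := IHn _ _ _ ltA TA BA; lia.
  + apply: (direct (2 * #|A|)); last by lia.
    by exists f', (#|B| + d + f); split=> //; lia.
Qed.

End CutSystem.

(** * Connected components and costs of partition trees *)

Section Components.
Variable V : finType.
Implicit Types (G H K : graph V) (A B C D X s t e f : {set V}).

Lemma connect_adj_sym G : connect_sym (adj G).
Proof. by apply: sym_connect_sym => x y; rewrite /adj setUC. Qed.

Lemma connect_inv (T : finType) (r : rel T) (P : pred T) x y :
  connect r x y -> P x ->
  (forall a b, connect r x a -> P a -> r a b -> P b) -> P y.
Proof.
move=> /connectP[p + ->] + step; elim/last_ind: p => //= p z IHp.
rewrite rcons_path last_rcons => /andP[rp rz] Px.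
by apply: step (IHp rp Px) rz; apply/connectP; exists p.
Qed.

Lemma component_of H C z : C \in components H -> z \in C ->
  C = [set y in vset H | connect (adj H) z y].
Proof.
case/imsetP=> x xH -> ; rewrite inE => /andP[_ xz].
apply/setP=> y; rewrite !inE; case: (y \in vset H) => //=.
exact: (same_connect (connect_adj_sym H) xz).
Qed.

Lemma component_neq0 H C : C \in components H -> C != set0.
Proof.
by case/imsetP=> x xH ->; apply/set0Pn; exists x; rewrite inE xH connect0.
Qed.

Lemma component_subset H C : C \in components H -> C \subset vset H.
Proof. by case/imsetP=> x _ ->; apply/subsetP=> y; rewrite inE => /andP[]. Qed.

Lemma component_eq H C D z :
  C \in components H -> D \in components H -> z \in C -> z \in D -> C = D.
Proof. by move=> HC HD zC zD; rewrite (component_of HC zC) (component_of HD zD). Qed.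

Lemma component_cover H z : z \in vset H ->
  exists2 C, C \in components H & z \in C.
Proof.
move=> zH; exists [set y in vset H | connect (adj H) z y].
  exact: imset_f.
by rewrite inE zH connect0.
Qed.

Lemma component_adj H C a b : simple_graph H -> C \in components H ->
  adj H a b -> a \in C -> b \in C.
Proof.
move=> sH HC ab aC; rewrite (component_of HC aC) inE connect1 // andbT.
by case: (sH _ ab) => _ /subsetP; apply; rewrite set22.
Qed.

Lemma component_edge H C f : simple_graph H -> C \in components H ->
  f \in eset H -> (f \subset C) || [disjoint f & C].
Proof.
move=> sH HC Hf; case: (sH _ Hf) => /eqP/cards2P[a [b [_ ef]]] _.
have ab : adj H a b by rewrite /adj -ef.
have ba : adj H b a by rewrite /adj setUC -ef.
have [aC|aC] := boolP (a \in C).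
  by rewrite ef subUset !sub1set aC (component_adj sH HC ab).
have bC : b \notin C by apply: contraNN aC; exact: component_adj ba.
apply/orP; right; apply/pred0P=> z /=; rewrite ef !inE.
by apply/negP=> /andP[/orP[]/eqP->]; apply/negP.
Qed.

(** A walk of [H] starting in [C] stays in [C], and its edges survive in [K], so [C] remains
    connected there. *)
Lemma component_sub H K C D : simple_graph H ->
  C \in components H -> D \in components K -> C \subset vset K ->
  (forall f, f \in eset H -> f \subset C -> f \in eset K) ->
  (C \subset D) || [disjoint C & D].
Proof.
move=> sH HC KD CK sub; have [//|] := boolP [disjoint C & D]; first by rewrite orbT.
case/pred0Pn=> z /= /andP[zC zD]; rewrite orbF; apply/subsetP=> y yC.
have := yC; rewrite (component_of HC zC) (component_of KD zD) !inE.
case/andP=> _ zy; rewrite (subsetP CK) //=.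
suff /andP[] : (y \in C) && connect (adj K) z y by [].
apply: (connect_inv (P := [pred y | (y \in C) && connect (adj K) z y]) zy).
  by rewrite /= zC connect0.
move=> a b za /andP[aC zaK] ab /=.
have bC := component_adj sH HC ab aC; rewrite bC /=.
apply: connect_trans zaK (connect1 _); apply: sub => //.
by rewrite subUset !sub1set aC.
Qed.

Lemma simple_del_edge G e : simple_graph G -> simple_graph (del_edge G e).
Proof. by move=> sG f /setD1P[_]; apply: sG. Qed.

Lemma simple_induced G X : simple_graph G -> simple_graph (induced G X).
Proof. by move=> sG f; rewrite inE => /andP[/sG[]]. Qed.

Lemma components2U H A B : components H = [set A; B] -> vset H = A :|: B.
Proof.
move=> HAB; apply/eqP; rewrite eqEsubset andbC subUset !component_subset ?HAB ?set21 ?set22 //=.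
apply/subsetP=> z /component_cover[C]; rewrite HAB inE.
by case/orP=> /set1P-> zC; rewrite inE zC ?orbT.
Qed.

Lemma components2_disjoint H A B :
  components H = [set A; B] -> A != B -> [disjoint A & B].
Proof.
move=> HAB neq; apply/pred0P=> z /=; apply/negP=> /andP[zA zB].
by case/eqP: neq; apply: (component_eq (H := H)) zA zB; rewrite HAB ?set21 ?set22.
Qed.

Lemma ept_leaves G T : is_ept G T -> leaves T =i vset G.
Proof.
elim=> {G T} [G v -> z|G e A B T1 T2 _ _ AB _ IH1 _ IH2 z].
  by rewrite !inE.
by rewrite [vset G](components2U AB) mem_cat IH1 IH2 inE.
Qed.

Lemma ept_cost_node G e A B T1 T2 : let H := del_edge G e in
  A != B -> components H = [set A; B] ->
  is_ept (induced H A) T1 ->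
  ept_cost G (Node e T1 T2) =
    #|vset G| + ept_cost (induced H A) T1 + ept_cost (induced H B) T2.
Proof.
move=> H neq AB ept1; have lv1 := ept_leaves ept1.
have dAB := components2_disjoint AB neq.
have eV : vset G = A :|: B := components2U AB.
rewrite /ept_cost /= eV cardsU (disjoint_setI0 dAB) cards0 subn0.
rewrite (_ : \sum_(v in A :|: B) _ =
             \sum_(v in A) leaf_depth (Node e T1 T2) v +
             \sum_(v in B) leaf_depth (Node e T1 T2) v); last first.
  by rewrite -bigU //; apply: eq_bigl => v; rewrite !inE.
rewrite -[RHS]addnA addnACA -!sum1_card -!big_split /=.
congr (_ + _); apply: eq_bigr => v vAB.
  by rewrite /= lv1 vAB add1n.
by rewrite /= lv1 /= (disjointFl dAB vAB) add1n.
Qed.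

Lemma balanced_cut_ept G T : balanced_cut G T -> is_ept G T.
Proof.
elim=> {G T} [G v Gv|G e A B T1 T2 [Ge _] neq AB _ ept1 _ ept2].
  exact: EptLeaf.
exact: EptNode Ge neq AB ept1 ept2.
Qed.

(** The given tree rules out the placeholder value 0 of [EPTsum]. *)
Lemma EPTsum_attained G T : is_ept G T ->
  exists2 T0, is_ept G T0 & ept_cost G T0 = EPTsum G.
Proof.
move=> GT; rewrite /EPTsum; case: pselect => [exG|[]]; last first.
  by exists (ept_cost G T); apply/asboolP; exists T.
by case: ex_minnP => m /asboolP[T0 GT0 <-] _; exists T0.
Qed.

End Components.

(** * The sides of the edges of a tree form a cut system *)

Section Sides.
Variables (V : finType) (G : graph V).
Hypotheses (sG : simple_graph G) (cG : connected G) (aG : acyclic G).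
Local Notation U := (vset G).
Implicit Types (A B C D X s t e f : {set V}).

(** Only the trace of [s] on [U] matters, and either it or its complement in [U] may be the
    component; this closes the family under complement in [V]. *)
Definition sides : {set {set V}} :=
  [set s | [exists e in eset G, (U :&: s \in components (del_edge G e))
                             || (U :\: s \in components (del_edge G e))]].

Lemma sidesC s : s \in sides -> ~: s \in sides.
Proof. rewrite !inE !setDE setCK => /exists_inP[e Ge sE].
by apply/exists_inP; exists e; rewrite // orbC. Qed.

(** A duplicate-free path joining the ends of [e] without using [e] would close up with [e] to a
    cycle. *)
Lemma edge_sub_component e C : e \in eset G -> C \in components (del_edge G e) ->
  ~~ (e \subset C).
Proof.
move=> Ge HC; apply/negP=> eC; case: (sG Ge) => /eqP/cards2P[x [y [xy ee]]] _.
have [xC yC] : x \in C /\ y \in C.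
  by move: eC; rewrite ee subUset !sub1set => /andP[].
have := yC; rewrite (component_of HC xC) inE => /andP[_ /connectP[p0 pp0]].
case/shortenP: pp0 => p pp up _ ey.
have subG a b : adj (del_edge G e) a b -> adj G a b by rewrite /adj inE => /andP[].
apply: (aG (c := x :: p)).
  (* The cycle has at least three vertices: an empty path would give [x = y], and a single step
     would be [e] itself. *)
  case: p pp up ey => [|z [|z' p]] //=; first by move=> _ _ yx; move: xy; rewrite yx eqxx.
  by rewrite andbT => + _ zy; rewrite -zy /adj -ee /= setD11.
rewrite /ucycle up andbT /= rcons_path (sub_path subG pp) -ey /=.
by rewrite /adj setUC -ee.
Qed.

Lemma component_sub_del e f C D : e \in eset G -> f \in eset G ->
  C \in components (del_edge G e) -> D \in components (del_edge G f) ->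
  ~~ (f \subset C) -> (C \subset D) || [disjoint C & D].
Proof.
move=> Ge Gf HC HD fC; apply: (component_sub (simple_del_edge sG) HC HD).
  exact: component_subset HC.
move=> g; rewrite !inE => /andP[_ ->] gC; rewrite andbT.
by apply: contraNneq fC => <-.
Qed.

Lemma components_cross e f C D : e \in eset G -> f \in eset G ->
  C \in components (del_edge G e) -> D \in components (del_edge G f) ->
  [|| C \subset D, [disjoint C & D], D \subset C | U \subset C :|: D].
Proof.
move=> Ge Gf HC HD.
have [fC|/(component_sub_del Ge Gf HC HD)/orP[]->] := boolP (f \subset C);
  rewrite ?orbT //.
have [eD|/(component_sub_del Gf Ge HD HC)/orP[]] := boolP (e \subset D);
  [|by move=> ->; rewrite !orbT|by rewrite disjoint_sym => ->; rewrite !orbT].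
(* Here [f] lies in [C] and [e] in [D]. Only [e] leaves [C] and only [f] leaves [D], so the union is
   closed under adjacency and connectedness makes it all of [U]. *)
suff -> : U \subset C :|: D by rewrite !orbT.
case/set0Pn: (component_neq0 HC) => x xC.
have xU := subsetP (component_subset HC) _ xC.
apply/subsetP=> y yU; apply: (connect_inv (P := mem (C :|: D)) (cG.2 _ _ xU yU)).
  by rewrite /= inE xC.
have step g A a b : A \in components (del_edge G g) -> adj G a b ->
    a \in A -> b \in A \/ [set a; b] = g.
  move=> HA ab aA; have [->|abg] := eqVneq [set a; b] g; first by right.
  left; apply: component_adj (simple_del_edge sG) HA _ aA.
  by rewrite /adj !inE abg.
move=> a b _ /=; rewrite !inE => /orP[aC|aD] ab.
  case: (step _ _ _ _ HC ab aC) => [->//|abe].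
  by rewrite (subsetP eD) ?orbT // -abe set22.
case: (step _ _ _ _ HD ab aD) => [->|abf]; first by rewrite orbT.
by rewrite (subsetP fC) // -abf set22.
Qed.

Ltac pointwise h :=
  let z := fresh "z" in
  apply/subsetP=> z; move: (h z); rewrite !inE;
  by repeat match goal with |- context [z \in ?A] => case: (z \in A) end => //=;
     move/(_ isT).

Lemma sides_cross s t : s \in sides -> t \in sides ->
  [|| U :&: s \subset t, [disjoint U :&: s & t], U :\: s \subset t
    | [disjoint U :\: s & t]].
Proof.
rewrite !inE => /exists_inP[e Ge sE] /exists_inP[f Gf tE].
rewrite !disjoints_subset.
case/orP: sE => HC; case/orP: tE => HD;
  case/or4P: (components_cross Ge Gf HC HD);
  rewrite ?disjoints_subset => /subsetP h; apply/or4P;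
  first [constructor 1; pointwise h | constructor 2; pointwise h
     | constructor 3; pointwise h | constructor 4; pointwise h].
Qed.

(* An edge of the tree that separates two vertices of [X] lies in [X]. *)
Definition convex X : Prop :=
  X \subset U /\
  forall f t, f \in eset G -> t \in components (del_edge G f) ->
    X :&: t != set0 -> X :\: t != set0 -> f \subset X.

Lemma convex_vset : convex U.
Proof. by split=> // f t Gf _ _ _; case: (sG Gf). Qed.

(** An edge not inside [s] has all of [s] on one side, so it cannot separate vertices of
    [X :&: s]. *)
Lemma convex_component X e s : convex X -> e \in eset G ->
  s \in components (del_edge G e) -> convex (X :&: s).
Proof.
move=> [XU cvX] Ge Hs; split; first by rewrite subIset ?XU.
move=> f t Gf Ht meet split.
have nosub : ~~ (s \subset t).
  apply: contraNN split => st; rewrite setD_eq0; apply: subset_trans st.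
  exact: subsetIr.
have nodis : ~~ [disjoint s & t].
  by apply: contraNN meet => /disjoint_setI0 st; rewrite -setIA st setI0.
have fs : f \subset s.
  apply: contraTT isT => fs.
  by have := component_sub_del Ge Gf Hs Ht fs; rewrite (negbTE nosub) (negbTE nodis).
rewrite subsetI fs andbT; apply: cvX Gf Ht _ _.
  by apply: contraNneq meet => Xt; rewrite setIAC Xt set0I.
apply: contraNneq split => /eqP; rewrite !setD_eq0; apply: subset_trans.
exact: subsetIl.
Qed.

(** Take for [s] the component of [G] minus [e] that meets [A]. It contains [A] and misses [B],
    since otherwise it would contain both ends of [e]. *)
Lemma cut_components X e A B : let H := del_edge (induced G X) e in
  X \subset U -> e \in eset (induced G X) -> A != B ->
  components H = [set A; B] ->
  [/\ exists2 s, s \in components (del_edge G e) & A = X :&: s /\ B = X :\: s,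
      cut sides U X A B & induced H A = induced G A].
Proof.
move=> H XU; rewrite inE => /andP[Ge eX] neq AB.
have sH : simple_graph H := simple_del_edge (simple_induced sG).
have HA : A \in components H by rewrite AB set21.
have HB : B \in components H by rewrite AB set22.
have eXAB : X = A :|: B := components2U AB.
have lift C s : C \in components H -> s \in components (del_edge G e) ->
    (C \subset s) || [disjoint C & s].
  move=> HC Hs; apply: (component_sub sH HC Hs).
    exact: subset_trans (component_subset HC) XU.
  by move=> f; rewrite !inE => /and3P[-> ->].
case/set0Pn: (component_neq0 HA) => x xA.
have xU : x \in U by rewrite (subsetP XU) // eXAB inE xA.
have [s Hs xs] := component_cover (xU : x \in vset (del_edge G e)).
have As : A \subset s.
  case/orP: (lift _ _ HA Hs) => // /pred0P/(_ x) /=.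
  by rewrite xA xs.
have Bs : [disjoint B & s].
  case/orP: (lift _ _ HB Hs) => // Bs; case/negP: (edge_sub_component Ge Hs).
  by apply: subset_trans eX _; rewrite eXAB subUset As.
have eA : A = X :&: s.
  by rewrite eXAB setIUl (disjoint_setI0 Bs) setU0; apply/esym/setIidPl.
have eB : B = X :\: s.
  apply/setP=> z; rewrite eXAB !inE; case: (boolP (z \in B)) => [zB|_].
    by rewrite (disjointFr Bs zB) orbT.
  by rewrite orbF andbC; case: (boolP (z \in A)) => //= /(subsetP As) ->.
split; first by exists s.
  split=> //; exists s; last by split=> //; [exact: component_neq0 HA|exact: component_neq0 HB].
  rewrite inE; apply/exists_inP; exists e => //.
  by rewrite (setIidPr (component_subset Hs)) Hs.
congr Graph; apply/setP=> f; rewrite !inE; case: (boolP (f \subset A)); rewrite ?andbF //.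
move=> fA; rewrite !andbT eXAB (subset_trans fA (subsetUl _ _)) andbT.
have -> // : f != e.
apply: contraNneq (edge_sub_component Ge Hs) => <-.
exact: subset_trans fA As.
Qed.

Lemma cut_tree_ept X T : X \subset U -> is_ept (induced G X) T ->
  cut_tree sides U X (ept_cost (induced G X) T).
Proof.
move=> XU; move eH : (induced G X) => H ept.
elim: ept => {H T} [H v Hv|H e A B T1 T2 He neq AB ept1 IH1 ept2 IH2] in X XU eH *.
  move: Hv; rewrite -eH /= => ->.
  by rewrite /ept_cost /= big1 //; apply: CutLeaf; rewrite cards1.
rewrite (ept_cost_node _ neq AB ept1) //; move: He AB IH1 IH2; rewrite -eH => He AB.
have [_ cAB iA] := cut_components XU He neq AB.
have BA := AB; rewrite setUC in BA; rewrite eq_sym in neq.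
have [_ _ iB] := cut_components XU He neq BA.
have [sAX sBX] := cut_subset cAB.
rewrite iA iB => IH1 IH2; apply: CutNode cAB _ _.
  by apply: IH1 => //; apply: subset_trans XU.
by apply: IH2 => //; apply: subset_trans XU.
Qed.

(** [balanced] compares [e] with the edges inside [X] only, [balanced_split] with every side that
    splits [X]; convexity puts the edge of such a side inside [X]. *)
Lemma balanced_split_cut X e A B : let H := induced G X in convex X ->
  balanced H e -> A != B -> components (del_edge H e) = [set A; B] ->
  balanced_split sides U X A B.
Proof.
move=> H [XU cvX] [He min] neq AB.
have [_ cAB _] := cut_components XU He neq AB; split=> // P Q.
have key f t : f \in eset G -> t \in components (del_edge G f) ->
    X :&: t != set0 -> X :\: t != set0 -> maxn #|A| #|B| <= maxn #|X :&: t| #|X :\: t|.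
  move=> Gf Ht Xt0 Xt1; have Hf : f \in eset H by rewrite inE Gf (cvX f t).
  apply: leq_trans (leq_trans _ (min _ Hf)) _; rewrite /largest_comp.
    rewrite geq_max AB; apply/andP; split.
      by apply: (@leq_bigmax_cond _ _ (fun C => #|C|)); rewrite set21.
    by apply: (@leq_bigmax_cond _ _ (fun C => #|C|)); rewrite set22.
  (* Each component left by [f] in [X] lies on one side of the cut, so the larger side bounds them
     all. *)
  apply/bigmax_leqP => C HC; have CX : C \subset X := component_subset HC.
  have sH : simple_graph (del_edge H f) := simple_del_edge (simple_induced sG).
  have : (C \subset t) || [disjoint C & t].
    apply: (component_sub sH HC Ht); first exact: subset_trans XU.
    by move=> g; rewrite !inE => /and3P[-> ->].
  rewrite leq_max => /orP[Ct|Ct]; apply/orP; [left|right]; apply: subset_leq_card.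
    by rewrite subsetI CX.
  by rewrite subsetD CX.
case=> _ [s]; rewrite inE => /exists_inP[f Gf /orP[]] Ht [-> -> P0 Q0].
  have eI : X :&: (U :&: s) = X :&: s by rewrite setIA (setIidPl XU).
  have eD : X :\: (U :&: s) = X :\: s.
    by rewrite setDIr (_ : X :\: U = set0) ?set0U //; apply/eqP; rewrite setD_eq0.
  by have := key _ _ Gf Ht; rewrite eI eD; apply.
have eI : X :&: (U :\: s) = X :\: s by rewrite setIDA (setIidPl XU).
have eD : X :\: (U :\: s) = X :&: s.
  by rewrite setDDr (_ : X :\: U = set0) ?set0U //; apply/eqP; rewrite setD_eq0.
by have := key _ _ Gf Ht; rewrite eI eD (maxnC #|X :\: s|); apply.
Qed.

Lemma balanced_tree_cut X T : convex X -> balanced_cut (induced G X) T ->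
  balanced_tree sides U X (ept_cost (induced G X) T).
Proof.
move=> cX; move eH : (induced G X) => H bal.
elim: bal => {H T} [H v Hv|H e A B T1 T2 bal neq AB bal1 IH1 bal2 IH2] in X cX eH *.
  move: Hv; rewrite -eH /= => ->.
  by rewrite /ept_cost /= big1 //; apply: BalancedLeaf; rewrite cards1.
rewrite (ept_cost_node _ neq AB (balanced_cut_ept bal1)) //.
move: bal AB IH1 IH2; rewrite -eH => bal AB.
have [XU _] := cX; have [He _] := bal.
have Ge : e \in eset G by move: He; rewrite inE => /andP[].
have [[s Hs [eA _]] _ iA] := cut_components XU He neq AB.
have BA := AB; rewrite setUC in BA; have neq' := neq; rewrite eq_sym in neq'.
have [[t Ht [eB _]] _ iB] := cut_components XU He neq' BA.
rewrite iA iB => IH1 IH2; apply: BalancedNode (balanced_split_cut cX bal neq AB) _ _.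
  by apply: IH1 => //; rewrite eA; apply: convex_component Hs.
by apply: IH2 => //; rewrite eB; apply: convex_component Ht.
Qed.

End Sides.

(** * Transfer of the bound to the tree [G] *)

Lemma induced_vset (V : finType) (G : graph V) :
  simple_graph G -> induced G (vset G) = G.
Proof.
case: G => U E sG; rewrite /induced /=; congr Graph.
apply/setP=> f; rewrite inE; case: (boolP (f \in E)) => //= Ef.
by have [] := sG f Ef.
Qed.

Import Order.TTheory GRing.Theory Num.Theory.
Local Open Scope ring_scope.

Theorem theorem2 (V : finType) (G : graph V) (T' : ptree V) :
  is_tree G -> balanced_cut G T' ->
  (ept_cost G T')%:R <= 3%:R / 2%:R * (EPTsum G)%:R :> rat.
Proof.
case=> sG cG aG bal.
have [T ept <-] := EPTsum_attained (balanced_cut_ept bal).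
rewrite -(induced_vset sG) in ept bal; rewrite -(induced_vset sG).
have opt := cut_tree_ept sG aG (subxx _) ept.
have balT := balanced_tree_cut sG aG (convex_vset sG) bal.
have := balanced_tree_approx (sidesC (G := G)) (sides_cross sG cG) opt balT.
by rewrite mulrAC ler_pdivlMr ?ltr0n // -!natrM ler_nat mulnC.
Qed.
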